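(* Every decomposable CSmodel is an intersection of a finite number of decomposable DAG models. Precisely: let $\mathcal T$ be a balanced CStree on $X_1,\dots,X_p$. Then there is a finite collection $\mathcal C$ of contexts $X_C=\mathbf x_C$ (with $C\subseteq[p]$, $\mathbf x_C\in\mathcal R_C$) and, for each of them, a perfect DAG $H_{X_C=\mathbf x_C}$ on the vertex set $[p]\setminus C$, such that $$\mathcal M(\mathcal T)=\bigcap_{(X_C=\mathbf x_C)\in\mathcal C}\Big\{f\in\Delta^\circ_{|\mathcal R|-1}:\ f(X_{[p]\setminus C}\mid X_C=\mathbf x_C)\in\mathcal M(H_{X_C=\mathbf x_C})\Big\}.$$
   Context: Notation. $[p]=\{1,\dots,p\}$; $X_1,\dots,X_p$ are discrete random variables, $X_i$ with state space $[d_i]=\{1,\dots,d_i\}$. For $A\subseteq[p]$ let $\mathcal R_A=\prod_{i\in A}[d_i]$, $\mathcal R=\mathcal R_{[p]}$. For $\mathbf x\in\mathcal R_B$ and $A\subseteq B$, $\mathbf x_A=(x_i)_{i\in A}$; for disjoint $A,B$, $\mathbf x_A\mathbf x_B\in\mathcal R_{A\cup B}$ is the combined outcome. $\Delta^\circ_{|\mathcal R|-1}$ is the set of strictly positive probability distributions on $\mathcal R$. CStrees. Let $\mathcal T=(V,E)$ be the rooted tree with $V=\{\mathrm{root}\}\cup\bigcup_{j\in[p]}\mathcal R_{[j]}$ and edges $\mathrm{root}\to x_1$ and $x_1\cdots x_{k-1}\to x_1\cdots x_k$. Its $k$-th level is $L_k=\mathcal R_{[k]}$ ($L_0=\{\mathrm{root}\}$);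 $E(v)$ is the set of outgoing edges of $v$. A labeling $\theta:E\to\mathcal L$ ($\mathcal L$ a finite set) makes $\mathcal T$ a staged tree if $|\theta(E(v))|=|E(v)|$ for all $v$, and $\theta(E(v)),\theta(E(w))$ are equal or disjoint for all $v,w$. Non-leaf vertices $v,w$ are in the same stage iff $\theta(E(v))=\theta(E(w))$; the equivalence classes are the stages (leaves are regarded as singleton stages). A staged tree is a CStree if: (1) $\theta(E(v))\ne\theta(E(w))$ for non-leaf $v,w$ in different levels; (2) $\theta(x_1\cdots x_{k-1}\to x_1\cdots x_{k-1}x_k)=\theta(y_1\cdots y_{k-1}\to y_1\cdots y_{k-1}x_k)$ whenever $x_1\cdots x_{k-1}$ and $y_1\cdots y_{k-1}$ are in the same stage; (3) for every $k\in[p]$ and every stage $S\subseteq L_{k-1}$ there are $C\subseteq[k-1]$ and $\mathbf x_C\in\mathcal R_C$ with $S=\{\mathbf x_C\mathbf y:\mathbf y\in\mathcal R_{[k-1]\setminus C}\}$. Model. $\mathcal M(\mathcal T)\subseteq\Delta^\circ_{|\mathcal R|-1}$ is the set of all $f$ of the form $f(\mathbf x)=\prod_{e\in E(\mathrm{root}\to\mathbf x)}x_{\theta(e)}$, where $E(\mathrm{root}\to\mathbf x)$ is the set of edges of the path from the root to $\mathbf x$, the parameters $x_{\theta(e)}\in(0,1)$ are indexed by labels, and $\sum_{e\in E(v)}x_{\theta(e)}=1$ for each non-leaf $v$. Balanced. For $v\in L_{k-1}$ let $t(v)=\sum_{\mathbf z\in\mathcal R_{[p]\setminus[k-1]}}\prod_{e\in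 E(v\to v\mathbf z)}\theta(e)$ in the polynomial ring $\mathbb R[\theta(e):e\in E]$ whose variables are the labels ($E(v\to v\mathbf z)$: edges on the path from $v$ to $v\mathbf z$). $\mathcal T$ is balanced if for every $k\in[p]$, all $v,w\in L_{k-1}$ in the same stage and all $s,r\in[d_k]$: $t(vs)t(wr)=t(vr)t(ws)$ in this ring. A decomposable CSmodel is a model $\mathcal M(\mathcal T)$ with $\mathcal T$ a balanced CStree. DAG models. All DAGs have edges $i\to j$ only with $i<j$. For a DAG $H$ on $W\subseteq[p]$, $\mathcal M(H)$ is the set of strictly positive distributions $g$ on $\mathcal R_W$ with $g(\mathbf x)=\prod_{v\in W}g(\mathbf x_v|\mathbf x_{\mathrm{pa}(v)})$ for all $\mathbf x\in\mathcal R_W$. $H$ is perfect if any two parents of a common vertex are adjacent; the model $\mathcal M(H)$ is decomposable iff $H$ is perfect. $f(X_{[p]\setminus C}\mid X_C=\mathbf x_C)$ denotes the conditional distribution on $\mathcal R_{[p]\setminus C}$.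
   Formalization: The formal theorem assumes d_i ≥ 2 for every i; if some d_i = 1, the parameters in (0,1) cannot sum to 1, so M(T) is empty while the intersection still contains the uniform distribution. *)

(* Defs.v *)
From mathcomp Require Import all_boot all_order all_algebra.
From mathcomp Require Import reals.
From mathcomp Require Import mpoly.

Set Implicit Arguments.
Unset Strict Implicit.
Unset Printing Implicit Defensive.

Import Order.TTheory GRing.Theory Num.Theory.
Local Open Scope ring_scope.

(* Indices and states are counted from 0: the variables X_1, ..., X_p are      *)
(* indexed by 'I_p, and the state space [d_i] is 'I_(d i).  The variables may  *)
(* be indexed by any finType J, so that the same notions apply to a subset of  *)
(* the variables, seen as a type.                                              *)

Definition outcome (J : finType) (d : J -> nat) : Type :=
  {dffun forall j : J, 'I_(d j)}.

Definition vars (J : finType) (A : {set J}) : Type := {j : J | j \in A}.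

Definition dim_on (J : finType) (d : J -> nat) (A : {set J}) : vars A -> nat :=
  fun j => d (val j).

(* R_A *)
Definition outcome_on (J : finType) (d : J -> nat) (A : {set J}) : Type :=
  outcome (dim_on d (A := A)).

(* x_A *)
Definition restr (J : finType) (d : J -> nat) (A : {set J}) (x : outcome d) :
    outcome_on d A :=
  finfun (fun j : vars A => x (val j)).

(* x_A x_B, for B the complement of A *)
Definition glue (J : finType) (d : J -> nat) (A : {set J})
    (x : outcome_on d A) (y : outcome_on d (~: A)) : outcome d :=
  finfun (fun j : J =>
    match decP (@idP (j \in A)) return 'I_(d j) with
    | left jA => x (exist _ j jA)
    | right jNA => y (exist _ j (introT setCP jNA))
    end).

Section Distributions.
Variables (R : realType) (J : finType) (d : J -> nat).

Definition pos_distr (f : outcome d -> R) : Prop :=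
  (forall x, 0 < f x) /\ \sum_x f x = 1.

Definition marginal (f : outcome d -> R) (A : {set J}) (xA : outcome_on d A) : R :=
  \sum_(y | restr A y == xA) f y.

(* f(X_{J \ C} | X_C = xC) *)
Definition conditional (f : outcome d -> R) (C : {set J}) (xC : outcome_on d C) :
    outcome_on d (~: C) -> R :=
  fun y => f (glue xC y) / marginal f xC.

End Distributions.

Section DAGs.
Variables (R : realType) (J : finType) (d : J -> nat) (H : rel J).

Definition parents (v : J) : {set J} := [set u | H u v].

Definition perfect : Prop :=
  forall v i j : J, i \in parents v -> j \in parents v -> i != j ->
    H i j || H j i.

(* g(x_v | x_pa(v)) *)
Definition cond_parents (g : outcome d -> R) (x : outcome d) (v : J) : R :=
  marginal g (restr (v |: parents v) x) / marginal g (restr (parents v) x).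

Definition dag_model (g : outcome d -> R) : Prop :=
  pos_distr g /\ forall x, g x = \prod_v cond_parents g x v.

End DAGs.

(* Every edge goes from a smaller to a larger index; this implies acyclicity.  *)
Definition ordered_dag (p : nat) (W : {set 'I_p}) (H : rel (vars W)) : Prop :=
  forall i j : vars W, H i j -> (val i < val j)%N.

(* A context X_C = x_C *)
Definition context (p : nat) (d : 'I_p -> nat) : Type :=
  {C : {set 'I_p} & outcome_on d C}.

Section Trees.
Variables (p : nat) (d : 'I_p -> nat).

Definition prec (k : nat) : {set 'I_p} := [set i : 'I_p | (i < k)%N].

(* The vertices of level k of the tree; level 0 has the root as its only       *)
(* element, and the non-leaf vertices are those of level k for k : 'I_p.       *)
Definition level (k : nat) : Type := outcome_on d (prec k).

Lemma prec_last (k i : 'I_p) :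
  i \in prec k.+1 -> ~ (i \in prec k) -> k = i.
Proof.
rewrite !inE ltnS => ik /negP; rewrite -leqNgt => ki.
by apply: val_inj; apply/eqP; rewrite eqn_leq ki ik.
Qed.

(* The end vertex vs of the edge v -> vs *)
Definition child (k : 'I_p) (v : level k) (s : 'I_(d k)) : level k.+1 :=
  finfun (fun i : vars (prec k.+1) =>
    match decP (@idP (val i \in prec k)) return 'I_(d (val i)) with
    | left ik => v (exist _ (val i) ik)
    | right iNk => ecast j 'I_(d j) (prec_last (valP i) iNk) s
    end).

(* An edge v -> vs is encoded by its level k, its source v in level k and the  *)
(* state s of the variable of index k.                                         *)
Definition labeling (Lab : finType) : Type :=
  forall k : 'I_p, level k -> 'I_(d k) -> Lab.

Variables (Lab : finType) (theta : labeling Lab).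

(* theta(E(v)) *)
Definition out_labels (k : 'I_p) (v : level k) : {set Lab} :=
  [set theta v s | s : 'I_(d k)].

Definition staged_tree : Prop :=
  (forall (k : 'I_p) (v : level k), #|out_labels v| = d k) /\
  (forall (j k : 'I_p) (v : level j) (w : level k),
     out_labels v = out_labels w \/ [disjoint out_labels v & out_labels w]).

Definition same_stage (j k : 'I_p) (v : level j) (w : level k) : bool :=
  out_labels v == out_labels w.

(* In a CStree, where distinct levels have no stage in common, this is the     *)
(* whole stage of v.                                                           *)
Definition stage (k : 'I_p) (v : level k) : {set level k} :=
  [set w : level k | same_stage v w].

Definition CStree : Prop :=
  [/\ staged_tree,
      forall (j k : 'I_p) (v : level j) (w : level k),
        j != k -> out_labels v <> out_labels w,
      forall (k : 'I_p) (v w : level k) (s : 'I_(d k)),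
        same_stage v w -> theta v s = theta w s
    & forall (k : 'I_p) (v : level k),
        exists (C : {set vars (prec k)})
               (xC : outcome_on (dim_on d (A := prec k)) C),
          stage v = [set glue xC y | y : outcome_on _ (~: C)] ].

(* The label of the edge of level k on the path from the root to the leaf x    *)
Definition path_label (x : outcome d) (k : 'I_p) : Lab :=
  theta (restr (prec k) x) (x k).

Definition tree_model (R : realType) (f : outcome d -> R) : Prop :=
  pos_distr f /\
  exists q : Lab -> R,
    [/\ forall (k : 'I_p) (v : level k) (s : 'I_(d k)), 0 < q (theta v s) < 1,
        forall (k : 'I_p) (v : level k), \sum_(s < d k) q (theta v s) = 1
      & forall x : outcome d, f x = \prod_(k < p) q (path_label x k)].

(* t(v), in the polynomial ring whose variables are the labels *)
Definition interpolating (R : realType) (k : nat) (v : level k) :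
    {mpoly R[#|Lab|]} :=
  \sum_(z : outcome_on d (~: prec k))
    \prod_(j < p | (k <= j)%N) 'X_(enum_rank (path_label (glue v z) j)).

Definition balanced (R : realType) : Prop :=
  forall (k : 'I_p) (v w : level k) (s r : 'I_(d k)), same_stage v w ->
    interpolating R (child v s) * interpolating R (child w r) =
    interpolating R (child v r) * interpolating R (child w s).

End Trees.

(* Main.v *)
Require Import Defs.
From mathcomp Require Import all_boot all_order all_algebra.
From mathcomp Require Import reals.
From mathcomp Require Import mpoly.

Set Implicit Arguments.
Unset Strict Implicit.
Unset Printing Implicit Defensive.

Import Order.TTheory GRing.Theory Num.Theory.
Local Open Scope ring_scope.

(* Write F_m(x) for the mass of the outcomes that agree with x on the first m  *)
(* variables.  A positive distribution belongs to the tree model iff each      *)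
(* ratio F_(m+1) / F_m only depends on the label of level m.                   *)
(* It suffices to use pairwise contexts: all variables but X_a and X_b are     *)
(* fixed, and H is the edgeless (hence perfect) graph on {a, b}, so that the   *)
(* condition says that f is of rank 1 on a square of outcomes.  The contexts   *)
(* chosen are those on whose square every label is a function of X_a alone or  *)
(* of X_b alone.                                                               *)
(* The tree model satisfies these conditions because f is a product of         *)
(* functions of labels.  For the converse, the rank 1 conditions are           *)
(* transported from F_(m+1) to F_m by downward induction: rank 1 of F_(m+1)    *)
(* lets one change the coordinates outside of the context of a stage one at a  *)
(* time, so F_(m+1) / F_m is a function of the labels of level m, and F_m is   *)
(* again of rank 1 provided that the labels of level m do not mix a and b.     *)
(* This is where balancedness enters: evaluated at positive parameters q that  *)
(* need not sum to 1, it says that the weight x |-> prod_k q(label_k(x))       *)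
(* satisfies the conditional independences of the tree; if the labels of       *)
(* levels < m did not mix a and b but those of level m did, then some q would  *)
(* violate this.                                                               *)

(** Two translations reduce the theorem to algebra. By [dag_model_context], the edgeless DAG on {a,
    b} in the context given by [x] means [rank1 f a b x], the vanishing of 2x2 minors on a square. A
    positive distribution satisfying [ratio_lab] at every level lies in the tree model
    ([ratio_lab_tree_model]), the ratios being the parameters. The selected squares are those where
    [sep] holds at all levels. That the tree model has rank 1 there is [tree_model_rank1], an
    instance of [rank1_prod]. The converse is the downward induction [rank1_ratio_labs], resting on
    [rank1_ratio_lab] and [balanced_sep]. The latter combines the geometry of stages
    ([nsep_isolated]) with balancedness read as a statement about unnormalised weights
    ([weight_ratio_lab]). *)

Section Outcomes.
Variables (J : finType) (d : J -> nat).
Implicit Types (A : {set J}) (x y z : outcome d).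

Definition mix A x y : outcome d :=
  finfun (fun j => if j \in A then y j else x j).

Lemma mixE A x y j : mix A x y j = if j \in A then y j else x j.
Proof. by rewrite ffunE. Qed.

Definition upd x (j : J) (s : 'I_(d j)) : outcome d := finfun (dfwith x s).

Lemma upd_same x j (s : 'I_(d j)) : upd x s j = s.
Proof. by rewrite ffunE dfwith_in. Qed.

Lemma upd_other x j (s : 'I_(d j)) i : i != j -> upd x s i = x i.
Proof. by move=> ij; rewrite ffunE dfwith_out // eq_sym. Qed.

Lemma restr_eqP A x y :
  reflect (forall j, j \in A -> x j = y j) (restr A x == restr A y).
Proof.
apply: (iffP eqP) => [/ffunP xy j jA|xy].
  by have := xy (exist _ j jA); rewrite !ffunE.
by apply/ffunP => -[j jA]; rewrite !ffunE; apply: xy.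
Qed.

Lemma glue_in A (u : outcome_on d A) v j (jA : j \in A) :
  glue u v j = u (exist _ j jA).
Proof.
rewrite ffunE; case: decP => [jA'|jNA]; last by exfalso; apply: jNA.
by rewrite (bool_irrelevance jA' jA).
Qed.

Lemma glue_out A (u : outcome_on d A) v j (jNA : j \in ~: A) :
  glue u v j = v (exist _ j jNA).
Proof.
rewrite ffunE; case: decP => [jA|jNA'].
  by exfalso; move: jNA; rewrite inE jA.
by rewrite (bool_irrelevance (introT setCP jNA') jNA).
Qed.

Lemma restr_glue A (u : outcome_on d A) v : restr A (glue u v) = u.
Proof. by apply/ffunP => -[j jA]; rewrite ffunE /= (glue_in _ _ jA). Qed.

Lemma restrC_glue A (u : outcome_on d A) v : restr (~: A) (glue u v) = v.
Proof. by apply/ffunP => -[j jA]; rewrite ffunE /= (glue_out _ _ jA). Qed.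

Lemma glue_restr A x y : glue (restr A x) (restr (~: A) y) = mix (~: A) x y.
Proof.
apply/ffunP => j; rewrite mixE inE; have [jA|jNA] /= := boolP (j \in A).
  by rewrite (glue_in _ _ jA) ffunE.
have jCA : j \in ~: A by rewrite inE.
by rewrite (glue_out _ _ jCA) ffunE.
Qed.

Lemma glueK A x : glue (restr A x) (restr (~: A) x) = x.
Proof. by rewrite glue_restr; apply/ffunP => j; rewrite mixE if_same. Qed.

Lemma sum_glue (V : nmodType) A (u : outcome_on d A) (F : outcome d -> V) :
  \sum_(y | restr A y == u) F y = \sum_z F (glue u z).
Proof.
rewrite (reindex_onto (glue u) (restr (~: A))) /=; last first.
  by move=> y /eqP <-; rewrite glueK.
by apply: eq_bigl => z; rewrite restr_glue restrC_glue !eqxx.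
Qed.

End Outcomes.

(** * Independence of two variables as a rank 1 condition *)

Section Independence.
Variables (R : realType).

Definition rank1 (J : finType) (d : J -> nat) (f : outcome d -> R) (a b : J)
    (x : outcome d) : Prop :=
  forall y z, restr (~: [set a; b]) y == restr (~: [set a; b]) x ->
    restr (~: [set a; b]) z == restr (~: [set a; b]) x ->
  f y * f z = f (mix [set a] y z) * f (mix [set a] z y).

Lemma dag_model_edgeless (J : finType) (d : J -> nat) (g : outcome d -> R) :
  dag_model (fun _ _ => false) g <->
  pos_distr g /\ forall x, g x = \prod_v \sum_(y : outcome d | y v == x v) g y.
Proof.
have E x v : pos_distr g ->
    cond_parents (fun _ _ => false) g x v = \sum_(y : outcome d | y v == x v) g y.
  case=> _ g1; rewrite /cond_parents /marginal.
  have -> : parents (fun _ _ : J => false) v = set0.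
    by apply/setP => j; rewrite !inE.
  rewrite [X in _ / X](_ : _ = 1) ?divr1; last first.
    rewrite -g1; apply: eq_bigl => y.
    by apply/restr_eqP => j; rewrite inE.
  apply: eq_bigl => y; apply/restr_eqP/eqP => [|yx j].
    by apply; rewrite !inE eqxx.
  by rewrite !inE orbF => /eqP ->.
split=> -[gpos gE]; split=> // x; rewrite gE.
  by apply: eq_bigr => v _; rewrite E.
by apply: eq_bigr => v _; rewrite E.
Qed.

(** A probability matrix is the product of its margins iff its 2x2 minors vanish. *)
Lemma dag_model_pair (J : finType) (d : J -> nat) (g : outcome d -> R)
    (a b : J) : a != b -> (forall j, (j == a) || (j == b)) -> pos_distr g ->
  dag_model (fun _ _ => false) g <->
  (forall y z, g y * g z = g (mix [set a] y z) * g (mix [set a] z y)).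
Proof.
move=> ab Jab gpos; rewrite dag_model_edgeless.
have ba : (b == a) = false by rewrite eq_sym (negbTE ab).
have prodE F : \prod_(v : J) F v = F a * F b :> R.
  rewrite (bigD1 a) //= (bigD1 b) /=; last by rewrite ba.
  rewrite big1 ?mulr1 // => j /andP[ja jb].
  by have := Jab j; rewrite (negbTE ja) (negbTE jb).
have eq2 (x y : outcome d) : x a = y a -> x b = y b -> x = y.
  by move=> xya xyb; apply/ffunP => j; have /orP[/eqP->|/eqP->] := Jab j.
have ma x y : mix [set a] x y a = y a by rewrite mixE inE eqxx.
have mb x y : mix [set a] x y b = x b by rewrite mixE inE ba.
split=> [[_ gE] y z|gE].
  rewrite !gE !prodE !(ma, mb) [LHS]mulrACA [RHS]mulrACA.
  by congr (_ * _); rewrite mulrC.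
split=> // x; rewrite prodE big_distrlr /= pair_big /=.
(* A pair of outcomes, one in the line of [x] fixing a and one in the line fixing b, amounts to one
   outcome [w] holding their two free coordinates. *)
rewrite (reindex_onto (fun w => (mix [set a] w x, mix [set a] x w))
           (fun u => mix [set a] u.1 u.2)) /=; last first.
  move=> [y z] /= /andP[/eqP ya /eqP zb].
  by congr pair; apply: eq2; rewrite ?(ma, mb).
rewrite -[LHS]mul1r -(proj2 gpos) big_distrl /=.
apply: eq_big => [w|w _].
  by rewrite !(ma, mb) !eqxx; apply/esym/eqP/eq2; rewrite !(ma, mb).
by rewrite gE; congr (_ * _); congr g; apply: eq2; rewrite !(ma, mb).
Qed.

Lemma pos_distr_conditional (J : finType) (d : J -> nat) (f : outcome d -> R)
    (C : {set J}) (u : outcome_on d C) :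
  pos_distr f -> 0 < marginal f u -> pos_distr (conditional f u).
Proof.
move=> [fpos _] Mpos; split=> [v|]; first exact: divr_gt0.
by rewrite -mulr_suml -sum_glue divff // gt_eqF.
Qed.

Lemma marginal_gt0 (J : finType) (d : J -> nat) (f : outcome d -> R)
    (A : {set J}) (x : outcome d) :
  (forall y, 0 < f y) -> 0 < marginal f (restr A x).
Proof.
move=> fpos; rewrite /marginal (bigD1 x) //=.
by rewrite ltr_wpDr // sumr_ge0 // => y _; apply: ltW.
Qed.

(** Conditioning divides [f] on the square by one positive constant, and the minors are
    homogeneous. *)
Lemma dag_model_context (J : finType) (d : J -> nat) (f : outcome d -> R)
    (a b : J) (x : outcome d) : a != b -> pos_distr f ->
  dag_model (fun _ _ => false)
    (conditional f (restr (~: [set a; b]) x)) <-> rank1 f a b x.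
Proof.
move=> ab fpos; set C := ~: [set a; b].
have Mpos : 0 < marginal f (restr C x) by apply: marginal_gt0 (proj1 fpos).
have aC : a \in ~: C by rewrite !inE eqxx.
have bC : b \in ~: C by rewrite !inE eqxx orbT.
pose a' : vars (~: C) := exist _ a aC; pose b' : vars (~: C) := exist _ b bC.
have ab' : a' != b' by apply: contra ab => /eqP[->].
have Jab j : (j == a') || (j == b').
  by have := valP j; rewrite !inE negbK.
rewrite (dag_model_pair ab' Jab) //; last exact: pos_distr_conditional.
have mixE y z : glue (restr C x) (mix [set a'] y z) =
    mix [set a] (glue (restr C x) y) (glue (restr C x) z).
  apply/ffunP => j; rewrite mixE; have [jC|jNC] := boolP (j \in C).
    by rewrite !(glue_in _ _ jC); rewrite if_same.
  have jCC : j \in ~: C by rewrite inE.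
  by rewrite !(glue_out _ _ jCC) mixE !inE.
split=> [gE y z|fE y z].
  move=> /eqP yx /eqP zx; have := gE (restr (~: C) y) (restr (~: C) z).
  have ey : glue (restr C x) (restr (~: C) y) = y by rewrite -yx glueK.
  have ez : glue (restr C x) (restr (~: C) z) = z by rewrite -zx glueK.
  rewrite /conditional !mixE ey ez mulrACA [RHS]mulrACA => /mulIf; apply.
  by rewrite mulf_neq0 // invr_neq0 // gt_eqF.
rewrite /conditional !mixE mulrACA [RHS]mulrACA; congr (_ * _).
by apply: fE; rewrite restr_glue.
Qed.

End Independence.

Lemma restrS (J : finType) (d : J -> nat) (A B : {set J}) (x y : outcome d) :
  A \subset B -> restr B x = restr B y -> restr A x = restr A y.
Proof.
move=> AB /eqP/restr_eqP xy; apply/eqP/restr_eqP => j jA.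
by apply: xy; apply: (subsetP AB).
Qed.

Lemma square_agree (J : finType) (d : J -> nat) (a b : J) (x y z : outcome d)
    (K : {set J}) :
  restr (~: [set a; b]) y == restr (~: [set a; b]) x ->
  restr (~: [set a; b]) z == restr (~: [set a; b]) x ->
  (a \in K -> y a = z a) -> (b \in K -> y b = z b) ->
  forall c, c \in K -> y c = z c.
Proof.
move=> /restr_eqP yx /restr_eqP zx ya yb c cK.
have [/setU1P[ca|/set1P cb]|cS] := boolP (c \in [set a; b]).
- by rewrite ca in cK *; apply: ya.
- by rewrite cb in cK *; apply: yb.
by rewrite yx ?zx // inE.
Qed.

Lemma square_mix (J : finType) (d : J -> nat) (a b : J) (x y z : outcome d) :
  restr (~: [set a; b]) y == restr (~: [set a; b]) x ->
  restr (~: [set a; b]) z == restr (~: [set a; b]) x ->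
  restr (~: [set a; b]) (mix [set a] y z) == restr (~: [set a; b]) x.
Proof.
move=> /restr_eqP yx /restr_eqP zx; apply/restr_eqP => c cS.
by rewrite mixE; case: ifP => _; [apply: zx|apply: yx].
Qed.

(** * The geometry of labels on squares of outcomes *)

Section Stages.
Variables (p : nat) (d : 'I_p -> nat) (Lab : finType) (theta : labeling d Lab).
Hypothesis theta_CStree : CStree theta.

Implicit Types (x y z : outcome d) (a b k : 'I_p).
Local Notation lab x k := (path_label theta x k).

Lemma labE x y k : (lab x k == lab y k) =
  same_stage theta (restr (prec p k) x) (restr (prec p k) y) && (x k == y k).
Proof.
have [[card_out disj] _ same _] := theta_CStree.
apply/eqP/andP => [xy|[vw /eqP xy]]; last first.
  by rewrite /path_label (same _ _ _ _ vw) xy.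
have vw : same_stage theta (restr (prec p k) x) (restr (prec p k) y).
  apply/eqP; have [//|] := disj _ _ (restr (prec p k) x) (restr (prec p k) y).
  move/pred0P/(_ (lab x k)); rewrite /= [X in X && _]imset_f //.
  by rewrite xy [X in _ && X]imset_f.
split=> //; apply/eqP.
have /imset_injP inj : #|out_labels theta (restr (prec p k) y)| == #|'I_(d k)|.
  by rewrite card_out card_ord.
by apply: inj; rewrite ?inE // -(same _ _ _ _ vw).
Qed.

Lemma lab_level x y j k : lab x j = lab y k -> j = k.
Proof.
have [[_ disj] diff _ _] := theta_CStree.
move=> xy; apply/eqP; apply/negP => /negP jk.
have [|] := disj _ _ (restr (prec p j) x) (restr (prec p k) y).
  exact: diff.
move/pred0P/(_ (lab x j)); rewrite /= [X in X && _]imset_f //.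
by rewrite xy [X in _ && X]imset_f.
Qed.

Lemma stage_cube k x : exists2 C : {set 'I_p}, C \subset prec p k &
  forall y, same_stage theta (restr (prec p k) x) (restr (prec p k) y) <->
    (forall c, c \in C -> y c = x c).
Proof.
have [_ _ _ /(_ k (restr (prec p k) x))[C [xC xE]]] := theta_CStree.
have stE y : same_stage theta (restr (prec p k) x) (restr (prec p k) y) =
    (restr C (restr (prec p k) y) == xC).
  transitivity (restr (prec p k) y \in stage theta (restr (prec p k) x)).
    by rewrite inE.
  rewrite xE; apply/imsetP/eqP => [[v _ ->]|<-]; first by rewrite restr_glue.
  by exists (restr (~: C) (restr (prec p k) y)); rewrite ?glueK.
exists [set val c | c in C] => [|y].
  by apply/subsetP => _ /imsetP[c _ ->]; apply: valP c.
have : same_stage theta (restr (prec p k) x) (restr (prec p k) x).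
  exact: eqxx.
rewrite !stE => /eqP <-; split=> [/restr_eqP yx _ /imsetP[c cC ->]|yx].
  by have := yx c cC; rewrite !ffunE.
apply/restr_eqP => c cC; rewrite !ffunE; apply: yx.
exact: imset_f.
Qed.

Lemma lab_cube k x : exists2 K : {set 'I_p}, K \subset prec p k.+1 &
  forall y, lab y k = lab x k <-> (forall c, c \in K -> y c = x c).
Proof.
have [C Ck CE] := stage_cube k x; exists (k |: C).
  apply/subsetP => c /setU1P[->|/(subsetP Ck)]; first by rewrite inE ltnSn.
  by rewrite !inE => /ltnW.
move=> y; split=> [/esym/eqP|yx].
  rewrite labE => /andP[/CE yx /eqP xyk] c /setU1P[->//|].
  exact: yx.
apply/esym/eqP; rewrite labE yx ?setU11 // eqxx andbT; apply/CE => c cC.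
by apply: yx; rewrite setU1r.
Qed.

Lemma lab_prec k x y :
  restr (prec p k.+1) x = restr (prec p k.+1) y -> lab x k = lab y k.
Proof.
move=> /eqP/restr_eqP xy; have [K Kk KE] := lab_cube k y.
by apply/KE => c /(subsetP Kk); apply: xy.
Qed.

Definition sep k a b x : bool :=
  let square y := restr (~: [set a; b]) y == restr (~: [set a; b]) x in
  [forall y, forall z, square y ==> square z ==> (y a == z a) ==>
     (lab y k == lab z k)] ||
  [forall y, forall z, square y ==> square z ==> (y b == z b) ==>
     (lab y k == lab z k)].

Lemma sepP k a b x :
  reflect ((forall y z, restr (~: [set a; b]) y == restr (~: [set a; b]) x ->
              restr (~: [set a; b]) z == restr (~: [set a; b]) x ->
              y a = z a -> lab y k = lab z k) \/
           (forall y z, restr (~: [set a; b]) y == restr (~: [set a; b]) x ->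
              restr (~: [set a; b]) z == restr (~: [set a; b]) x ->
              y b = z b -> lab y k = lab z k))
          (sep k a b x).
Proof.
have E (i : 'I_p) : reflect
    (forall y z, restr (~: [set a; b]) y == restr (~: [set a; b]) x ->
       restr (~: [set a; b]) z == restr (~: [set a; b]) x ->
       y i = z i -> lab y k = lab z k)
    [forall y : outcome d, forall z : outcome d,
       (restr (~: [set a; b]) y == restr (~: [set a; b]) x) ==>
       (restr (~: [set a; b]) z == restr (~: [set a; b]) x) ==>
       (y i == z i) ==> (lab y k == lab z k)].
  apply: (iffP forallP) => [H y z yx zx yz|H y].
    by have /forallP/(_ z) := H y; rewrite yx zx yz eqxx => /eqP.
  apply/forallP => z; apply/implyP => yx; apply/implyP => zx.
  by apply/implyP => /eqP yz; apply/eqP/H.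
by apply: (iffP orP) => -[/E|/E]; [left|right|left|right].
Qed.

(** A label of level k does not see the later variable X_b. *)
Lemma sep_prec k a b x : (k < b)%N -> sep k a b x.
Proof.
move=> kb; apply/sepP; left=> y z yx zx yz; have [K Kk KE] := lab_cube k z.
apply/KE; apply: (square_agree yx zx) => [//|/(subsetP Kk)].
by rewrite inE ltnNge kb.
Qed.

(** By [lab_cube], each label occupies a point, a line or all of the square. If no label occupied a
    single point, failure of both alternatives of [sep] would give two full lines in different
    directions with different labels; but such lines cross. *)
Lemma nsep_isolated k a b x : ~~ sep k a b x ->
  exists2 u, restr (~: [set a; b]) u == restr (~: [set a; b]) x &
    forall y, lab y k = lab u k -> y a = u a /\ y b = u b.
Proof.
rewrite negb_or => /andP[/forallPn[y /forallPn[z nyz]]].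
move: nyz; rewrite !negb_imply => /and4P[yx zx /eqP yza nyz].
move=> /forallPn[y' /forallPn[z' nyz']].
move: nyz'; rewrite !negb_imply => /and4P[yx' zx' /eqP yzb' nyz'].
have [K _ KE] := lab_cube k y; have [K' _ KE'] := lab_cube k y'.
have bK : b \in K.
  apply: contraNT nyz => bK; apply/eqP/esym/KE.
  by apply: (square_agree zx yx) => // bK'; rewrite bK' in bK.
have aK' : a \in K'.
  apply: contraNT nyz' => aK'; apply/eqP/esym/KE'.
  by apply: (square_agree zx' yx') => // aK; rewrite aK in aK'.
have [aK|aK] := boolP (a \in K).
  by exists y => // w /KE wy; rewrite !wy.
have [bK'|bK'] := boolP (b \in K').
  by exists y' => // w /KE' wy; rewrite !wy.
have [ab|ab] := eqVneq a b; first by rewrite ab bK in aK.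
have mb u v : mix [set a] u v b = u b by rewrite mixE inE eq_sym (negbTE ab).
have ma u v : mix [set a] u v a = v a by rewrite mixE inE eqxx.
have row u : restr (~: [set a; b]) u == restr (~: [set a; b]) x ->
    lab (mix [set a] y u) k = lab y k.
  move=> ux; apply/KE; apply: (square_agree (square_mix yx ux) yx) => //.
  by rewrite (negbTE aK).
(* The lines through [y] and [y'] meet at [mix [set a] y y'], which carries both labels. *)
have yy' : lab y k = lab y' k.
  rewrite -(row _ yx'); apply/KE'.
  apply: (square_agree (square_mix yx yx') yx') => //.
  by rewrite (negbTE bK').
have := row _ zx'; rewrite yy' => /KE'/(_ a aK'); rewrite ma => yza'.
case/eqP: nyz'; congr (path_label _ _ _); apply/ffunP => c.
by apply/esym/(square_agree (K := setT) zx' yx'); rewrite ?inE.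
Qed.

End Stages.

(** * Masses of prefixes *)

Section Marginals.
Variables (R : realType) (p : nat) (d : 'I_p -> nat).
Implicit Types (x y z : outcome d) (f : outcome d -> R) (k : 'I_p).

Definition prefix_marginal f (m : nat) x : R := marginal f (restr (prec p m) x).

Lemma eq_prefix_marginal f m x y : restr (prec p m) x = restr (prec p m) y ->
  prefix_marginal f m x = prefix_marginal f m y.
Proof. by rewrite /prefix_marginal => ->. Qed.

Lemma prefix_marginal_gt0 f m x :
  (forall y, 0 < f y) -> 0 < prefix_marginal f m x.
Proof. exact: marginal_gt0. Qed.

Lemma prefix_marginal0 f x : prefix_marginal f 0 x = \sum_y f y.
Proof. by apply: eq_bigl => y; apply/restr_eqP => j; rewrite inE. Qed.

Lemma prefix_marginal_full f x : prefix_marginal f p x = f x.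
Proof.
rewrite /prefix_marginal /marginal (big_pred1 x) // => y.
apply/restr_eqP/eqP => [yx|-> //].
by apply/ffunP => j; rewrite yx // inE.
Qed.

Lemma restr_precS k x y :
  (restr (prec p k.+1) x == restr (prec p k.+1) y) =
  (restr (prec p k) x == restr (prec p k) y) && (x k == y k).
Proof.
apply/restr_eqP/andP => [xy|[/restr_eqP xy /eqP xyk] j].
  split; last by rewrite xy // inE.
  by apply/restr_eqP => j; rewrite !inE => jk; rewrite xy // inE ltnW.
rewrite inE ltnS leq_eqVlt => /orP[/eqP/val_inj->//|jk].
by rewrite xy // inE.
Qed.

Lemma restr_prec_upd k x (s : 'I_(d k)) :
  restr (prec p k) (upd x s) = restr (prec p k) x.
Proof.
apply/eqP/restr_eqP => j; rewrite inE => jk; rewrite upd_other //.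
by rewrite -val_eqE /= ltn_eqF.
Qed.

Lemma prefix_marginalS f k x :
  prefix_marginal f k x = \sum_(s < d k) prefix_marginal f k.+1 (upd x s).
Proof.
rewrite /prefix_marginal /marginal (partition_big (fun y => y k) predT) //=.
apply: eq_bigr => s _; apply: eq_bigl => y.
by rewrite restr_precS restr_prec_upd upd_same.
Qed.

Lemma prefix_marginal_prod f m x : (forall y, 0 < f y) -> (m <= p)%N ->
  prefix_marginal f m x = (\sum_y f y) *
    \prod_(k < p | (k < m)%N)
       (prefix_marginal f k.+1 x / prefix_marginal f k x).
Proof.
move=> fpos; elim: m => [|m IH] mp.
  by rewrite prefix_marginal0 [X in _ * X]big_pred0 ?mulr1 // => k; rewrite ltn0.
rewrite (bigD1 (Ordinal mp)) //= mulrCA.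
rewrite (eq_bigl (fun k : 'I_p => (k < m)%N)) => [|k]; last first.
  by rewrite ltnS andbC -val_eqE /= -ltn_neqAle.
by rewrite -(IH (ltnW mp)) divfK // gt_eqF // prefix_marginal_gt0.
Qed.

End Marginals.

(** * Rank 1 conditions and ratios of prefix masses *)

Section Tree.
Variables (R : realType) (p : nat) (d : 'I_p -> nat).
Variables (Lab : finType) (theta : labeling d Lab).
Hypothesis theta_CStree : CStree theta.

Implicit Types (x y z : outcome d) (f : outcome d -> R) (a b k : 'I_p).
Local Notation lab x k := (path_label theta x k).

(** Exchanging the coordinate a of two points of the square either swaps the two values of a factor
    or leaves them alone, according to which alternative of [sep] holds. *)
Lemma rank1_prod (P : pred 'I_p) (u : 'I_p -> outcome d -> R) a b x :
  (forall k y z, P k -> lab y k = lab z k -> u k y = u k z) ->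
  a != b -> (forall k, P k -> sep theta k a b x) ->
  rank1 (fun y => \prod_(k | P k) u k y) a b x.
Proof.
move=> u_lab ab sepP_ y z yx zx; rewrite -!big_split /=; apply: eq_bigr => k Pk.
have ma v w : mix [set a] v w a = w a by rewrite mixE inE eqxx.
have mb v w : mix [set a] v w b = v b.
  by rewrite mixE inE eq_sym (negbTE ab).
have yzx := square_mix yx zx; have zyx := square_mix zx yx.
have [H|H] := sepP _ _ _ _ _ (sepP_ k Pk).
  rewrite mulrC (u_lab _ y (mix [set a] z y)) //.
    by rewrite (u_lab _ z (mix [set a] y z)) //; apply: H.
  exact: H.
rewrite (u_lab _ y (mix [set a] y z)) //; last by apply: H.
by rewrite (u_lab _ z (mix [set a] z y)) //; apply: H.
Qed.

Lemma tree_model_rank1 f a b x : tree_model theta f -> a != b ->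
  (forall k, sep theta k a b x) -> rank1 f a b x.
Proof.
move=> [_ [q [_ _ fE]]] ab sep_all.
move=> y z yx zx; rewrite !fE.
by apply: (@rank1_prod predT (fun k y => q (lab y k)) a b x) => // k v w _ ->.
Qed.

Definition ratio_lab f k : Prop := forall x y, lab x k = lab y k ->
  prefix_marginal f k.+1 x / prefix_marginal f k x =
  prefix_marginal f k.+1 y / prefix_marginal f k y.

Lemma rank1_prefix_marginal f m a b x : (forall y, 0 < f y) -> (m <= p)%N ->
  (forall k, (k < m)%N -> ratio_lab f k) ->
  a != b -> (forall k, (k < m)%N -> sep theta k a b x) ->
  rank1 (prefix_marginal f m) a b x.
Proof.
move=> fpos mp ratio ab sep_m y z yx zx.
rewrite !(prefix_marginal_prod _ fpos mp) mulrACA [RHS]mulrACA.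
congr (_ * _).
pose u k y := prefix_marginal f k.+1 y / prefix_marginal f k y.
apply: (@rank1_prod (fun k => k < m)%N u a b x) => // k v w km.
exact: ratio.
Qed.

(** Two outcomes with the same label of level k agree on the context C of the stage and at k. The
    other coordinates below k are changed one at a time, each change using rank 1 on the square of
    that coordinate and k. *)
Lemma rank1_ratio_lab f k : (forall y, 0 < f y) ->
  (forall a x, (a < k)%N ->
     (forall j : 'I_p, (j < k.+1)%N -> sep theta j a k x) ->
     rank1 (prefix_marginal f k.+1) a k x) ->
  ratio_lab f k.
Proof.
move=> fpos rank1_k x y xy.
have [C Ck CE] := stage_cube theta_CStree k x.
have /andP[/CE yxC /eqP xyk] :
    same_stage theta (restr (prec p k) x) (restr (prec p k) y) && (x k == y k).
  by rewrite -(labE theta_CStree) xy.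
pose r z := prefix_marginal f k.+1 z / prefix_marginal f k z.
(* The path from [x] to [y] takes its first n coordinates from [y]. *)
suff H n : (n <= k)%N -> r (mix (prec p n) x y) = r x.
  rewrite -/(r x) -/(r y) -(H k) //; congr (_ / _).
    apply/eq_prefix_marginal/eqP; rewrite restr_precS mixE inE ltnn xyk eqxx.
    by rewrite andbT; apply/restr_eqP => j jk; rewrite mixE jk.
  by apply/eq_prefix_marginal/eqP/restr_eqP => j jk; rewrite mixE jk.
elim: n => [|n IH] nk.
  by congr r; apply/ffunP => j; rewrite mixE inE.
rewrite -(IH (ltnW nk)).
have np : (n < p)%N by apply: ltn_trans nk (ltn_ord k).
pose a := Ordinal np; set z := mix (prec p n) x y.
set z' := mix (prec p n.+1) x y.
have z'E (j : 'I_p) : j != a -> z' j = z j.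
  by move=> ja; rewrite !mixE !inE ltnS leq_eqVlt -[j == n :> nat]/(j == a) (negbTE ja).
have agree (w w' : outcome d) : (forall j, j \in C -> w j = x j) ->
    (forall j, j \in C -> w' j = x j) -> w k = w' k -> lab w k = lab w' k.
  move=> /CE xw /CE xw' wk; apply/eqP; rewrite (labE theta_CStree) wk eqxx andbT.
  by rewrite /same_stage -(eqP xw).
have zC j : j \in C -> z j = x j.
  by move=> jC; rewrite mixE; case: ifP => // _; apply: yxC.
have z'C j : j \in C -> z' j = x j.
  by move=> jC; rewrite mixE; case: ifP => // _; apply: yxC.
have [aC|aC] := boolP (a \in C).
  congr r; apply/ffunP => j; have [->|/z'E//] := eqVneq j a.
  by rewrite zC ?z'C.
have ak : a != k by rewrite -val_eqE /= ltn_eqF.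
have sq (w : outcome d) : (forall j, j != a -> j != k -> w j = z j) ->
    restr (~: [set a; k]) w == restr (~: [set a; k]) z.
  move=> wz; apply/restr_eqP => j; rewrite !inE negb_or => /andP[ja jk].
  exact: wz.
(* Lower levels do not see X_k. At level k, neither a nor k is in C, so the whole square lies over
   one stage and the label depends on X_k alone. *)
have sepz (j : 'I_p) : (j < k.+1)%N -> sep theta j a k z.
  rewrite ltnS leq_eqVlt => /orP[/eqP/val_inj->|/(sep_prec theta_CStree)//].
  apply/sepP; right => w w' /restr_eqP wz /restr_eqP wz' wk.
  have inS c : c \in C -> c \in ~: [set a; k].
    move=> cC; rewrite !inE negb_or; apply/andP; split.
      by apply: contraNneq aC => <-.
    by have := subsetP Ck c cC; rewrite inE -val_eqE /= => /ltn_eqF->.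
  by apply: agree => // c cC; rewrite ?wz ?wz' ?inS // zC.
have swap (s : 'I_(d k)) :
    prefix_marginal f k.+1 z * prefix_marginal f k.+1 (upd z' s) =
    prefix_marginal f k.+1 z' * prefix_marginal f k.+1 (upd z s).
  rewrite (rank1_k a z nk sepz z (upd z' s)) ?eqxx //; last first.
    by apply: sq => j ja jk; rewrite upd_other ?z'E.
  congr (_ * _); apply: (congr1 (prefix_marginal f k.+1)).
    apply/ffunP => j; rewrite mixE inE; case: eqP => [->|/eqP ja].
      by rewrite upd_other.
    by rewrite z'E.
  apply/ffunP => j; rewrite mixE inE; case: eqP => [->|/eqP ja].
    by rewrite upd_other.
  have [->|jk] := eqVneq j k; first by rewrite !upd_same.
  by rewrite !upd_other ?z'E.
have nz w : prefix_marginal f k w != 0 by rewrite gt_eqF ?prefix_marginal_gt0.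
(* After cross-multiplication, [swap] summed over all states s of X_k is the claim. *)
apply/eqP; rewrite /r eqr_div //.
rewrite !(prefix_marginalS f k) !big_distrr /=; apply/eqP/eq_bigr => s _.
by rewrite swap.
Qed.


(** * Balancedness evaluated at positive parameters *)

Lemma child_restr k x (s : 'I_(d k)) :
  restr (prec p k.+1) (upd x s) = child (restr (prec p k) x) s.
Proof.
(* The index i is generalised so that the equation in the cast can be eliminated. *)
have castE i (e : k = i) : dfwith x s i = ecast j 'I_(d j) e s.
  by case: _ / e; rewrite dfwith_in.
apply/ffunP => -[i ik]; rewrite !ffunE /=; case: decP => [ik'|ik'].
  rewrite ffunE /= dfwith_out // eq_sym -val_eqE /= ltn_eqF //.
  by move: ik'; rewrite inE.
exact: castE.
Qed.

Section Weights.
Variable q : Lab -> R.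
Hypothesis q_gt0 : forall l, 0 < q l.

Definition weight x : R := \prod_k q (lab x k).

Lemma weight_gt0 x : 0 < weight x.
Proof. by apply: prodr_gt0. Qed.

Definition eval_interpolating (m : nat) (v : level d m) : R :=
  (interpolating theta R v).@[fun i => q (enum_val i)].

Lemma prefix_marginal_weight m x :
  prefix_marginal weight m x =
  (\prod_(k < p | (k < m)%N) q (lab x k)) *
  eval_interpolating (restr (prec p m) x).
Proof.
rewrite /prefix_marginal /marginal sum_glue /eval_interpolating /interpolating.
rewrite raddf_sum /= big_distrr /=; apply: eq_bigr => z _.
rewrite rmorph_prod /weight (bigID (fun k : 'I_p => (k < m)%N)) /=.
congr (_ * _).
  apply: eq_bigr => k km; congr q; apply: (lab_prec theta_CStree).
  have sub : prec p k.+1 \subset prec p m.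
    by apply/subsetP => j; rewrite !inE => /leq_trans; apply.
  by apply: restrS sub _; rewrite restr_glue.
apply: eq_big => [k|k _]; first by rewrite -leqNgt.
by rewrite mevalXU enum_rankK.
Qed.

Lemma prefix_marginal_weight_upd k x (s : 'I_(d k)) :
  prefix_marginal weight k.+1 (upd x s) =
  (\prod_(j < p | (j < k)%N) q (lab x j)) * (q (theta (restr (prec p k) x) s) *
  eval_interpolating (child (restr (prec p k) x) s)).
Proof.
rewrite prefix_marginal_weight child_restr (bigD1 k) //= -mulrA mulrCA.
rewrite /path_label restr_prec_upd upd_same.
congr (_ * _); apply: eq_big => [j|j jk].
  by rewrite ltnS andbC -val_eqE /= -ltn_neqAle.
have {}jk : (j < k)%N by move: jk; rewrite ltnS andbC -val_eqE /= -ltn_neqAle.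
congr q; apply: (lab_prec theta_CStree); apply: restrS (restr_prec_upd x s).
by apply/subsetP => i; rewrite !inE => ij; apply: leq_trans ij jk.
Qed.

(** Cross-multiply and expand each mass of level k over the states r of X_k. The sums agree term by
    term: the edge labels coincide within a stage, and the remaining factors are t(vs)t(wr) =
    t(vr)t(ws) evaluated at [q]. *)
Lemma weight_ratio_lab k : balanced theta R -> ratio_lab weight k.
Proof.
have [_ _ same _] := theta_CStree.
move=> bal x y /eqP; rewrite (labE theta_CStree) => /andP[vw /eqP xyk].
have nz z : prefix_marginal weight k z != 0.
  by rewrite gt_eqF // prefix_marginal_gt0 // => w; apply: weight_gt0.
apply/eqP; rewrite eqr_div // !(prefix_marginalS weight k) !big_distrr /=.
apply/eqP/eq_bigr => r _.
have updE z : upd z (z k) = z.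
  apply/ffunP => j; have [->|jk] := eqVneq j k; first by rewrite upd_same.
  by rewrite upd_other.
rewrite -{1}(updE x) -{2}(updE y) -xyk !prefix_marginal_weight_upd.
rewrite mulrACA [RHS]mulrACA [X in _ = X * _]mulrC; congr (_ * _).
rewrite mulrACA [RHS]mulrACA !(same _ _ _ _ vw).
congr (_ * _); rewrite /eval_interpolating -mevalM (bal _ _ _ _ r vw) mevalM.
exact: mulrC.
Qed.

End Weights.

(** * Descending through the levels and recovering parameters *)

Hypothesis d_ge2 : forall i : 'I_p, (1 < d i)%N.

Lemma exists_other (i : 'I_p) (s : 'I_(d i)) : exists t : 'I_(d i), t != s.
Proof.
have [s0|s0] := eqVneq (val s) 0%N.
  by exists (Ordinal (d_ge2 i)); rewrite -val_eqE /= s0.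
by exists (Ordinal (ltnW (d_ge2 i))); rewrite -val_eqE /= eq_sym.
Qed.

Lemma prefix_marginal_cst m x y :
  prefix_marginal (fun=> 1 : R) m x = prefix_marginal (fun=> 1) m y.
Proof. by rewrite /prefix_marginal /marginal !sum_glue. Qed.

(* If a label of level [m] occurred at a single point of the square, doubling  *)
(* its parameter would increase the mass of that point only.                   *)
Lemma balanced_sep (m : 'I_p) a b x : balanced theta R ->
  a != b -> (a < m)%N -> (b < m)%N ->
  (forall k, (k < m)%N -> sep theta k a b x) -> sep theta m a b x.
Proof.
move=> bal ab am bm sep_m; apply: contraT => /(nsep_isolated theta_CStree).
case=> u ux u_isol; pose q l : R := if l == lab u m then 2 else 1.
have q_gt0 l : 0 < q l by rewrite /q; case: ifP.
have weightE y : weight q y = if lab y m == lab u m then 2 else 1.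
  rewrite /weight (bigD1 m) //= big1 ?mulr1 // => k km.
  rewrite /q; case: eqP => // /(lab_level theta_CStree) e.
  by rewrite e eqxx in km.
have weight_ge1 y : 1 <= weight q y by rewrite weightE; case: ifP; rewrite ?ler1n.
pose N := prefix_marginal (fun=> 1 : R) m u.
have NE y : (y a != u a) || (y b != u b) -> prefix_marginal (weight q) m y = N.
  move=> yu; rewrite /N -(prefix_marginal_cst m y); apply: eq_bigr => z.
  move=> /restr_eqP zy; rewrite weightE; case: eqP => // /u_isol[za zb].
  by move: yu; rewrite -!zy ?inE // za zb !eqxx.
have N_gt0 : 0 < N by apply: prefix_marginal_gt0.
have uN : N < prefix_marginal (weight q) m u.
  rewrite /N /prefix_marginal /marginal (bigD1 u) //= [ltRHS](bigD1 u) //=.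
  by rewrite ltr_leD ?ler_sum // weightE eqxx ltr1n.
have [s sa] := exists_other (u a); have [t tb] := exists_other (u b).
(* [v] is a corner opposite to [u]: it and the two mixed corners all have mass N, so rank 1 would
   force the mass N on [u] too. *)
pose v := upd (upd u s) t.
have va : v a = s by rewrite /v upd_other // upd_same.
have vb : v b = t by rewrite /v upd_same.
have vx : restr (~: [set a; b]) v == restr (~: [set a; b]) x.
  rewrite -(eqP ux); apply/restr_eqP => j; rewrite !inE negb_or.
  by case/andP => ja jb; rewrite /v !upd_other.
have rank1_m : rank1 (prefix_marginal (weight q) m) a b x.
  apply: rank1_prefix_marginal => //; first exact: weight_gt0.
    exact: ltnW.
  by move=> k _; apply: weight_ratio_lab.
have := rank1_m u v ux vx.
rewrite (NE v) ?va ?sa // (NE (mix _ u v)) ?mixE ?inE ?eqxx ?va ?sa //.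
rewrite (NE (mix _ v u)); last first.
  by rewrite !mixE !inE [b == a]eq_sym (negbTE ab) vb tb orbT.
by move=> /mulIf e; move: uN; rewrite e ?ltxx // gt_eqF.
Qed.

(** Downward induction on [P m]. The top case is the hypothesis on [f], and [P k.+1] yields
    [ratio_lab f k]. *)
Lemma rank1_ratio_labs f : balanced theta R -> (forall x, 0 < f x) ->
  (forall a b x, a != b -> (forall k, sep theta k a b x) -> rank1 f a b x) ->
  forall k, ratio_lab f k.
Proof.
move=> bal fpos rank1_f.
pose P m := forall a b x, a != b -> (a < m)%N -> (b < m)%N ->
  (forall k, (k < m)%N -> sep theta k a b x) ->
  rank1 (prefix_marginal f m) a b x.
have ratioP (k : 'I_p) : P k.+1 -> ratio_lab f k.
  move=> Pk; apply: rank1_ratio_lab => // a x ak sep_k.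
  by apply: Pk; rewrite // ?ltnS ?(ltnW ak) // -val_eqE /= ltn_eqF.
have P_step (m : 'I_p) : P m.+1 -> P m.
  move=> Pm a b x ab am bm sep_m y z yx zx.
  have sepm : sep theta m a b x by apply: balanced_sep.
  (* F_m is F_(m+1) times this factor, a function of the label of level m, which is separated on the
     square. *)
  pose u (k : 'I_p) y := prefix_marginal f k y / prefix_marginal f k.+1 y.
  have uE w : prefix_marginal f m w =
      prefix_marginal f m.+1 w * \prod_(k | k == m) u k w.
    by rewrite big_pred1_eq /u mulrCA divff ?mulr1 // gt_eqF // prefix_marginal_gt0.
  rewrite !uE mulrACA [RHS]mulrACA; congr (_ * _).
    have sep_m1 (k : 'I_p) : (k < m.+1)%N -> sep theta k a b x.
      by rewrite ltnS leq_eqVlt => /orP[/eqP/val_inj->|/sep_m].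
    exact: (Pm a b x ab (leqW am) (leqW bm) sep_m1 y z yx zx).
  have u_lab k v w : k == m -> lab v k = lab w k -> u k v = u k w.
    move=> /eqP-> vw.
    by rewrite /u -[LHS]invf_div -[RHS]invf_div (ratioP m Pm v w vw).
  have sep_k k : k == m -> sep theta k a b x by move/eqP->.
  exact: (rank1_prod u_lab ab sep_k).
have P_all n : (n <= p)%N -> P (p - n)%N.
  elim: n => [_|n IH np].
    rewrite subn0 => a b x ab _ _ sep_p y z yx zx; rewrite !prefix_marginal_full.
    by apply: (rank1_f a b x) => // k; apply: sep_p.
  have mp : (p - n.+1 < p)%N by rewrite ltn_subrL (leq_trans _ np).
  by apply: (P_step (Ordinal mp)); rewrite /= subnSK //; apply/IH/ltnW.
move=> k; apply: ratioP; rewrite -(subKn (ltn_ord k)).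
exact/P_all/leq_subr.
Qed.

Lemma ratio_lab_tree_model f : pos_distr f ->
  (forall k, ratio_lab f k) -> tree_model theta f.
Proof.
move=> fdistr ratio; split=> //; have [fpos f1] := fdistr.
(* Any edge carrying the label serves, by [ratio]; labels on no edge get the default 0. *)
pose q l : R := if [pick t : 'I_p * outcome d | lab t.2 t.1 == l] is Some t
  then prefix_marginal f t.1.+1 t.2 / prefix_marginal f t.1 t.2 else 0.
have qE k x : q (lab x k) = prefix_marginal f k.+1 x / prefix_marginal f k x.
  rewrite /q; case: pickP => [[j y] /= /eqP yx|/(_ (k, x))]; last by rewrite eqxx.
  have jk := lab_level theta_CStree yx; rewrite jk in yx *.
  exact: ratio.
have qtheta k (v : level d k) : exists x, forall s,
    q (theta v s) = prefix_marginal f k.+1 (upd x s) / prefix_marginal f k x.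
  pose x := glue v (finfun (fun j => Ordinal (ltnW (d_ge2 (val j))))).
  exists x => s; have -> : theta v s = lab (upd x s) k.
    by rewrite /path_label restr_prec_upd upd_same restr_glue.
  by rewrite qE; congr (_ / _); apply/eq_prefix_marginal/restr_prec_upd.
have Fpos m x : 0 < prefix_marginal f m x by apply: prefix_marginal_gt0.
exists q; split=> [k v s|k v|x].
- have [x ->] := qtheta k v; rewrite divr_gt0 //= ltr_pdivrMr // mul1r.
  (* A second state of X_k carries positive mass, which makes the parameter less than 1. *)
  have [t ts] := exists_other s.
  rewrite (prefix_marginalS f) (bigD1 s) //= ltrDl (bigD1 t) //=.
  by rewrite ltr_wpDr // sumr_ge0 // => r _; apply: ltW.
- have [x xE] := qtheta k v; under eq_bigr do rewrite xE.
  by rewrite -mulr_suml -prefix_marginalS divff // gt_eqF.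
rewrite -[LHS]prefix_marginal_full prefix_marginal_prod // f1 mul1r.
by apply: eq_big => [k|k _]; rewrite ?ltn_ord // qE.
Qed.

End Tree.

(* The contexts and their edgeless graphs *)
Local Close Scope ring_scope.

Theorem theorem1p3 (R : realType) (p : nat) (d : 'I_p -> nat)
    (d_ge2 : forall i : 'I_p, 1 < d i)
    (Lab : finType) (theta : labeling d Lab)
    (theta_CStree : CStree theta) (theta_balanced : balanced theta R) :
  exists (CC : {set context d})
         (H : forall c : context d, rel (vars (~: tag c))),
    (forall c : context d, c \in CC -> ordered_dag (H c) /\ perfect (H c)) /\
    (forall f : outcome d -> R,
       tree_model theta f <->
       pos_distr f /\
       (forall c : context d, c \in CC ->
          dag_model (H c) (conditional f (tagged c)))).
Proof.
pose ctx (t : 'I_p * 'I_p * outcome d) : context d :=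
  existT (fun C : {set 'I_p} => outcome_on d C) (~: [set t.1.1; t.1.2])
    (restr (~: [set t.1.1; t.1.2]) t.2).
pose good (t : 'I_p * 'I_p * outcome d) :=
  (t.1.1 != t.1.2) && [forall k, sep theta k t.1.1 t.1.2 t.2].
exists [set ctx t | t in good], (fun _ _ _ => false); split=> [c _|f].
  by split=> // v i j; rewrite inE.
split=> [ft|[fdistr f_dag]].
  have [fdistr _] := ft; split=> // _ /imsetP[[[a b] x] /andP[/= ab /forallP sp] ->].
  by apply/dag_model_context => //; apply: tree_model_rank1 ft ab sp.
apply: ratio_lab_tree_model => //.
apply: rank1_ratio_labs => // [x|a b x ab sp]; first exact: (proj1 fdistr).
apply/dag_model_context => //; apply: (f_dag (ctx (a, b, x))).
by apply: imset_f; rewrite unfold_in /good /= ab; apply/forallP.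
Qed.
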